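(* Every distinct covering system of congruences has a modulus divisible by either $2$ or $3$.
   Context: A covering system of congruences is a finite collection of residue classes $a_i \bmod m_i$, $i=1,2,\dots,k$, such that every integer satisfies at least one of the congruences $x\equiv a_i \pmod{m_i}$. A covering system is distinct if the moduli $m_1,\dots,m_k$ are pairwise distinct and all greater than $1$. *)

(* Defs.v *)
From mathcomp Require Import all_boot all_order all_algebra.
Set Implicit Arguments.
Unset Strict Implicit.
Unset Printing Implicit Defensive.

Definition covering_system (k : nat) (a : 'I_k -> int) (m : 'I_k -> nat) : Prop :=
  (forall i, 0 < m i) /\
  (forall x : int, exists i, (x = a i %[mod (m i)%:Z])%Z).

Definition distinct_covering_system
    (k : nat) (a : 'I_k -> int) (m : 'I_k -> nat) : Prop :=
  [/\ covering_system a m, injective m & forall i, 1 < m i].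

(* Main.v *)
Require Import Defs.
From Stdlib Require Import BinNat Nnat.
From mathcomp Require Import all_boot all_order all_algebra.
From mathcomp Require Import zify ring lra.

(** The proof is the distortion method of Balister, Bollobas, Morris,
    Sahasrabudhe and Tiba.  Let [Q] be the product of the moduli and suppose
    that [Q] is coprime to 6.  Moduli being distinct, at most one residue class
    is used for each divisor [d > 1] of [Q], so it is enough to show that
    whatever class is chosen for every such [d], some [x] avoids all of them
    ([uncovered_of_coprime_6]).

    The primes of [Q] are treated in increasing order.  At each stage there is
    a probability weight [w] on the residues modulo the part [M] of [Q] built
    from the primes treated so far, under which the classes whose modulus
    divides [M] have total mass at most [C].  Starting from the uniform weight
    on the residues modulo 1, the aim is to keep [C < 1] until [M = Q].

    When the prime power [p ^ v] comes in, each residue [x] modulo [M] becomes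
    a fiber of [p ^ v] residues modulo [M * p ^ v], a proportion [alpha x] of
    which is hit by the new classes.  If [alpha x] is below a threshold
    [delta], the mass of [x] is spread over the rest of its fiber, and the new
    classes receive nothing.  Otherwise the weight grows by the factor
    [1 / (1 - delta)] outside of the new classes, which receive what remains
    ([exists_distortion]).  In both cases the weight grows at most by the
    factor [1 / (1 - delta)], and the mass given to the new classes is at most
    [alpha x ^ 2 / (4 * delta * (1 - delta))].

    It remains to bound the mean of [alpha ^ 2].  A class modulo [m * p ^ j]
    meets a fiber in a proportion [p ^ - j] if it meets it at all, hence
    [alpha] is at most the sum over [j >= 1] of [p ^ - j] times the number of
    [m] dividing [M] for which [x] lies in a prescribed class modulo [m].  So
    the induction also carries a bound [P] on the mean of the square of such
    counts, uniform in the choice of the classes.  One step multiplies [P] by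
    [1 + (3 * p - 1) / ((1 - delta) * (p - 1) ^ 2)] and adds
    [P / ((p - 1) ^ 2 * 4 * delta * (1 - delta))] to [C]
    ([has_weight_pfactor]).

    With [delta = 1 / 5] at every prime, the theorem becomes the numerical
    statement that [cost n < 16 / 25] for all [n], where [growth] and [cost]
    accumulate these contributions over all primes from 5 on ([cost_lt]).  Up
    to 8400 it is checked by a rounded computation.  Beyond, the primes are
    only known to be coprime to 210: there are at most 48 of them in each
    interval of length 210, which is sparse enough, as [3 / (1 - delta)] times
    the density [48 / 210] is less than 1, so that [growth n] is less than
    linear and the sum of [growth p / (p - 1) ^ 2] converges
    ([cost_potential]). *)

Set Implicit Arguments.
Unset Strict Implicit.
Unset Printing Implicit Defensive.
Import Order.TTheory GRing.Theory Num.Theory.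
Local Open Scope ring_scope.

(** * Averages over residues and over fibers *)

Definition avg (M : nat) (f : nat -> rat) : rat := (\sum_(x < M) f x) / M%:R.

(** Functions on the residues modulo [M * q] are represented by periodic
    functions on [nat]; the fiber of [x] is the set of the [x + j * M] with
    [j < q], so that no recourse to the Chinese remainder theorem is needed to
    describe it. *)
Definition fiber_avg (M q : nat) (f : nat -> rat) (x : nat) : rat :=
  avg q (fun j => f (x + j * M)%N).

Definition periodic (M : nat) (f : nat -> rat) : Prop :=
  forall x, f (x + M)%N = f x.

Lemma eq_avg M f g : f =1 g -> avg M f = avg M g.
Proof. by move=> fg; rewrite /avg; congr (_ / _); apply: eq_bigr. Qed.

Lemma avgD M f g : avg M (fun x => f x + g x) = avg M f + avg M g.
Proof. by rewrite /avg big_split mulrDl. Qed.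

Lemma avgZ M c f : avg M (fun x => c * f x) = c * avg M f.
Proof. by rewrite /avg -mulr_sumr mulrA. Qed.

Lemma avg_sum M (I : Type) (s : seq I) (F : I -> nat -> rat) :
  avg M (fun x => \sum_(i <- s) F i x) = \sum_(i <- s) avg M (F i).
Proof. by rewrite /avg exchange_big /= mulr_suml. Qed.

Lemma ler_avg M f g : (forall x, f x <= g x) -> avg M f <= avg M g.
Proof.
move=> fg; rewrite /avg ler_wpM2r ?invr_ge0 ?ler0n //.
by apply: ler_sum => i _.
Qed.

Lemma avg_cst M c : (0 < M)%N -> avg M (fun=> c) = c.
Proof.
move=> M0; rewrite /avg sumr_const card_ord -[c *+ M]mulr_natr mulfK //.
by rewrite pnatr_eq0 -lt0n.
Qed.

Lemma periodicMn M f k x : periodic M f -> f (x + k * M)%N = f x.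
Proof.
move=> fM; elim: k => [|k IHk]; first by rewrite addn0.
by rewrite mulSn [(M + _)%N]addnC addnA fM.
Qed.

Lemma avg_fiber M q f : avg (M * q) f = avg M (fiber_avg M q f).
Proof.
rewrite /fiber_avg {2 3}/avg -mulr_suml exchange_big /= /avg natrM invfM.
rewrite mulrA [RHS]mulrAC; congr (_ / _ / _).
elim: q => [|q IHq]; first by rewrite muln0 !big_ord0.
rewrite big_ord_recr /= -IHq mulnS addnC big_split_ord /=; congr (_ + _).
  by apply: eq_bigr => i _; rewrite addnC mulnC.
Qed.

(** A function of the residue modulo [M] is constant on fibers: the fiber
    average is a conditional expectation. *)
Lemma fiber_avgMl M q f g x : periodic M g ->
  fiber_avg M q (fun y => g y * f y) x = g x * fiber_avg M q f x.
Proof.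
move=> gM; rewrite /fiber_avg -avgZ; apply: eq_avg => j /=.
by rewrite periodicMn.
Qed.

Lemma avg_periodic M q f : (0 < q)%N -> periodic M f -> avg (M * q) f = avg M f.
Proof.
move=> q0 fM; rewrite avg_fiber; apply: eq_avg => x.
rewrite /fiber_avg -[RHS](avg_cst _ q0); apply: eq_avg => j.
exact: periodicMn.
Qed.

Lemma periodic_fiber_avg M q f : (0 < q)%N -> periodic (M * q) f ->
  periodic M (fiber_avg M q f).
Proof.
case: q => // q _ fMq x; rewrite /fiber_avg /avg; congr (_ / _).
rewrite big_ord_recr big_ord_recl /= [RHS]addrC; congr (_ + _); last first.
  by rewrite mul0n addn0 -[RHS]fMq mulnS addnA [(q * M)%N]mulnC.
by apply: eq_bigr => i _; rewrite /bump /= add1n mulSn addnA.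
Qed.

Definition congr_ind (a m x : nat) : rat := (x == a %[mod m])%N%:R.

Lemma periodic_congr_ind a m M : (m %| M)%N -> periodic M (congr_ind a m).
Proof.
by move=> /dvdnP[k ->] x; rewrite /congr_ind addnC modnMDl.
Qed.

(** Independence of coprime moduli: as [M] is invertible modulo [s], the
    points [x + j * M] with [j < s] run through all residues modulo [s]. *)
Lemma fiber_avg_congr_ind M s q a x : (0 < q)%N -> (s %| q)%N -> coprime M s ->
  fiber_avg M q (congr_ind a s) x = s%:R^-1.
Proof.
move=> q0 /dvdnP[k def_q] cMs; move: q0; rewrite {}def_q muln_gt0 mulnC.
move=> /andP[k0 s0].
rewrite /fiber_avg avg_periodic //; last first.
  move=> j; rewrite /congr_ind mulnDl [(s * M)%N]mulnC.
  by rewrite [(j * M + _)%N]addnC addnCA modnMDl.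
case: s cMs s0 => // s cMs _; rewrite /avg -[RHS]mul1r; congr (_ / _).
pose h (j : 'I_s.+1) : 'I_s.+1 := inord ((x + j * M) %% s.+1)%N.
have hE j : h j = ((x + j * M) %% s.+1)%N :> nat by rewrite inordK // ltn_mod.
have h_inj : injective h.
  move=> i j /(congr1 val); rewrite /= !hE => /eqP; rewrite eqn_modDl.
  (* Two points with the same residue have s.+1 dividing (j' - i') * M. *)
  have wlog_le (i' j' : 'I_s.+1) : (i' <= j')%N ->
      (i' * M == j' * M %[mod s.+1])%N -> i' = j'.
    move=> le_ij; rewrite eq_sym eqn_mod_dvd ?leq_mul2r ?le_ij ?orbT //.
    rewrite -mulnBl Gauss_dvdl 1?coprime_sym // => /dvdn_leq.
    move=> lesub; apply/val_inj/eqP; rewrite eqn_leq le_ij /=.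
    rewrite leqNgt; apply/negP => lt_ij.
    have := lesub; rewrite subn_gt0 => /(_ lt_ij).
    by rewrite leqNgt ltnS (leq_trans (leq_subr _ _)) // -ltnS.
  have [le_ij|/ltnW le_ij] := leqP i j => eq_ij; first exact: wlog_le.
  by symmetry; apply: wlog_le => //; rewrite eq_sym.
transitivity (\sum_(i < s.+1) (h i == inord (a %% s.+1)%N)%:R : rat).
  by apply: eq_bigr => j _; rewrite -val_eqE /= hE inordK // ltn_mod.
rewrite -(reindex_inj h_inj (P := predT) (F := fun i => (i == inord (a %% s.+1)%N)%:R)).
rewrite (bigD1 (inord (a %% s.+1)%N)) //= eqxx big1 ?addr0 // => i.
by move=> /negPf ->.
Qed.

(** * Redistributing the mass of a fiber *)

Lemma fiber_avg_ind_bounds M q (b : nat -> bool) x : (0 < q)%N ->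
  0 <= fiber_avg M q (fun y => (b y)%:R) x <= 1.
Proof.
move=> q0; apply/andP; split.
  by rewrite -[leLHS](avg_cst _ q0); apply: ler_avg => j; rewrite ler0n.
by rewrite -[leRHS](avg_cst _ q0); apply: ler_avg => j; case: (b _).
Qed.

(** The mass of the fiber of [x] is shared between [b] and its complement in
    proportions [beta] and [1 - beta], uniformly on each, with
    [beta = max 0 ((alpha - delta) / (1 - delta))]: this is the smallest share
    of [b] for which the density stays below [1 / (1 - delta)] off [b].  The
    last bound is [4 * delta * (alpha - delta) <= alpha ^ 2], that is,
    [0 <= (alpha - 2 * delta) ^ 2]. *)
Lemma exists_distortion (delta : rat) M q (b : nat -> bool) :
    0 < delta < 1 -> (0 < q)%N -> (forall x, b (x + M * q)%N = b x) ->
  exists phi : nat -> rat,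
    [/\ forall x, 0 <= phi x <= (1 - delta)^-1,
        periodic (M * q) phi,
        forall x, fiber_avg M q phi x = 1
      & forall x, fiber_avg M q (fun y => phi y * (b y)%:R) x <=
          fiber_avg M q (fun y => (b y)%:R) x ^+ 2
            / (4 * delta * (1 - delta))].
Proof.
move=> /andP[d0 d1] q0 bP.
set alpha := fiber_avg M q (fun y => (b y)%:R).
have aM : periodic M alpha.
  by apply: periodic_fiber_avg => // x; rewrite bP.
have d10 : 0 < 1 - delta by rewrite subr_gt0.
pose beta x : rat := Num.max 0 ((alpha x - delta) / (1 - delta)).
have a01 x : 0 <= alpha x <= 1 by exact: fiber_avg_ind_bounds.
have b0 x : 0 <= beta x by rewrite /beta le_max lexx.
have ba x : beta x <= alpha x / (1 - delta).
  have /andP[a0 a1] := a01 x.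
  rewrite /beta ge_max divr_ge0 ?(ltW d10) //= ler_pM2r ?invr_gt0 //.
  by rewrite gerBl ltW.
have cb x : 0 <= 1 - beta x <= (1 - alpha x) / (1 - delta).
  have /andP[a0 a1] := a01 x.
  pose t : rat := (1 - alpha x) / (1 - delta); rewrite -/t.
  have t0 : 0 <= t by rewrite divr_ge0 ?(ltW d10) ?subr_ge0.
  have -> : beta x = Num.max 0 (1 - t).
    by rewrite /beta; congr Num.max; rewrite /t; field; lra.
  by case: (ltP 0 (1 - t)) => h'; apply/andP; split; lra.
(* If alpha is 0 or 1, one of the quotients is 0 / 0 = 0, and its part of the
   fiber is empty. *)
pose u x : rat := beta x / alpha x; pose v x : rat := (1 - beta x) / (1 - alpha x).
have uM : periodic M u by move=> x; rewrite /u /beta aM.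
have vM : periodic M v by move=> x; rewrite /v /beta aM.
have ua x : u x * alpha x = beta x.
  rewrite /u; have [a0|a0] := eqVneq (alpha x) 0; last by rewrite divfK.
  by rewrite a0 mulr0; apply/esym/le_anti; rewrite b0 (le_trans (ba x)) // a0 mul0r.
have va x : v x * (1 - alpha x) = 1 - beta x.
  rewrite /v; have [a0|a0] := eqVneq (1 - alpha x) 0; last by rewrite divfK.
  rewrite a0 mulr0; apply/esym/le_anti; have := cb x.
  by rewrite a0 mul0r andbC.
have u01 x : 0 <= u x <= (1 - delta)^-1.
  have /andP[a0 a1] := a01 x; rewrite divr_ge0 //=.
  have [a00|a00] := eqVneq (alpha x) 0.
    by rewrite /u a00 invr0 mulr0 invr_ge0 ltW.
  by rewrite /u ler_pdivrMr ?lt0r ?a00 // mulrC.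
have v01 x : 0 <= v x <= (1 - delta)^-1.
  have /andP[a0 a1] := a01 x; have /andP[c0 c1] := cb x.
  have c2 : 0 <= 1 - alpha x by rewrite subr_ge0.
  rewrite divr_ge0 //=.
  have [a00|a00] := eqVneq (1 - alpha x) 0.
    by rewrite /v a00 invr0 mulr0 invr_ge0 ltW.
  by rewrite /v ler_pdivrMr ?lt0r ?a00 // mulrC.
have fib_u x : fiber_avg M q (fun y => u y * (b y)%:R) x = beta x.
  by rewrite fiber_avgMl.
exists (fun y => if b y then u y else v y); split.
- by move=> x; case: (b x).
- by move=> x; rewrite bP mulnC !periodicMn.
- move=> x; rewrite /fiber_avg.
  rewrite (@eq_avg _ _ (fun j => u (x + j * M)%N * (b (x + j * M)%N)%:R
      + v (x + j * M)%N * (1 + (-1) * (b (x + j * M)%N)%:R))); last first.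
    by move=> j; case: (b _) => /=; ring.
  rewrite avgD -/(fiber_avg M q (fun y => u y * (b y)%:R) x) fib_u.
  rewrite -/(fiber_avg M q (fun y => v y * (1 + (-1) * (b y)%:R)) x).
  rewrite fiber_avgMl // {1}/fiber_avg avgD avgZ avg_cst //.
  by rewrite -/(alpha x) mulN1r va addrC subrK.
- move=> x; rewrite {1}/fiber_avg.
  rewrite (@eq_avg _ _ (fun j => u (x + j * M)%N * (b (x + j * M)%N)%:R)).
    rewrite -/(fiber_avg M q (fun y => u y * (b y)%:R) x) fib_u.
    have /andP[a0 a1] := a01 x.
    rewrite /beta ge_max divr_ge0 ?sqr_ge0 ?mulr_ge0 ?(ltW d0) ?(ltW d10) //=.
    rewrite invfM mulrA ler_pM2r ?invr_gt0 // ler_pdivlMr ?mulr_gt0 //.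
    by have := sqr_ge0 (alpha x - 2 * delta); nra.
  by move=> j; case: (b _); rewrite ?mulr0.
Qed.

(** * Counting the classes that contain a point *)

Lemma perm_divisors_pfactor M p v :
    prime p -> coprime M p -> (0 < M)%N ->
  perm_eq (divisors (M * p ^ v)) [seq (m * p ^ j)%N | j <- iota 0 v.+1, m <- divisors M].
Proof.
move=> p_pr cMp M0; have p0 := prime_gt0 p_pr.
have pmd m : m \in divisors M -> coprime p m.
  by rewrite -dvdn_divisors // => mM; rewrite coprime_sym (coprime_dvdl mM).
apply: uniq_perm; first exact: divisors_uniq.
  apply: allpairs_uniq; rewrite ?iota_uniq ?divisors_uniq //.
  move=> [i m] [j m'] /allpairsPdep[i1 [m1 [_ m1M [-> ->]]]].
  move=> /allpairsPdep[j2 [m2 [_ m2M [-> ->]]]] /= eqp.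
  have eqij : i1 = j2.
    have := congr1 (logn p) eqp.
    have m10 : (0 < m1)%N by move: m1M; rewrite -dvdn_divisors // => /dvdn_gt0->.
    have m20 : (0 < m2)%N by move: m2M; rewrite -dvdn_divisors // => /dvdn_gt0->.
    by rewrite !lognM ?expn_gt0 ?p0 // !pfactorK // !logn_coprime ?pmd.
  move: eqp; rewrite eqij => /eqP; rewrite eqn_pmul2r ?expn_gt0 ?p0 //.
  by move=> /eqP ->.
move=> d; rewrite -dvdn_divisors ?muln_gt0 ?M0 ?expn_gt0 ?p0 //.
apply/idP/allpairsPdep => [dM|[j [m []]]].
  have d0 : (0 < d)%N by rewrite (dvdn_gt0 _ dM) // muln_gt0 M0 expn_gt0 p0.
  have [m cpm def_d] := pfactor_coprime p_pr d0.
  exists (logn p d), m; split=> //.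
  - rewrite mem_iota add0n ltnS.
    have Mpv0 : (0 < M * p ^ v)%N by rewrite muln_gt0 M0 expn_gt0 p0.
    have := dvdn_leq_log p Mpv0 dM.
    by rewrite lognM ?expn_gt0 ?p0 // pfactorK // [logn p M]logn_coprime 1?coprime_sym.
  - rewrite -dvdn_divisors // -(@Gauss_dvdl _ _ (p ^ v)) //.
      by rewrite (dvdn_trans _ dM) // def_d dvdn_mulr.
    by rewrite coprimeXr // coprime_sym.
rewrite mem_iota add0n ltnS -dvdn_divisors // => jv mM ->.
by rewrite dvdn_mul // dvdn_exp2l.
Qed.

Lemma congr_ind_ge0 a m x : 0 <= congr_ind a m x.
Proof. exact: ler0n. Qed.

Lemma congr_indM a m s x : coprime m s ->
  congr_ind a (m * s) x = congr_ind a m x * congr_ind a s x.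
Proof.
by move=> cms; rewrite /congr_ind chinese_remainder // -natrM mulnb.
Qed.

Definition hits (a : nat -> nat) (M x : nat) : rat :=
  \sum_(d <- divisors M) congr_ind (a d) d x.

(** The part of [hits a (M * p ^ v)] that comes from the divisors in which [p]
    has exponent [j]. *)
Definition layer (a : nat -> nat) (p j M x : nat) : rat :=
  \sum_(m <- divisors M) congr_ind (a (m * p ^ j)%N) (m * p ^ j) x.

Definition layer_residues (a : nat -> nat) (p j : nat) : nat -> nat :=
  fun m => a (m * p ^ j)%N.

Lemma layer_ge0 a p j M x : 0 <= layer a p j M x.
Proof. by apply: sumr_ge0 => d _; exact: congr_ind_ge0. Qed.

Lemma periodic_hits a M : (0 < M)%N -> periodic M (hits a M).
Proof.
move=> M0 x; apply: eq_big_seq => d; rewrite -dvdn_divisors // => dM.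
exact: periodic_congr_ind.
Qed.

Lemma layer0 a p M x : layer a p 0 M x = hits a M x.
Proof. by apply: eq_bigr => d _; rewrite expn0 muln1. Qed.

Section PrimePower.

Variables (M p v : nat).
Hypotheses (p_pr : prime p) (cMp : coprime M p) (M0 : (0 < M)%N).

Let z : rat := p%:R^-1.
Let q := (p ^ v)%N.

Let q0 : (0 < q)%N. Proof. by rewrite expn_gt0 prime_gt0. Qed.

Let cdp d j : (d %| M)%N -> coprime d (p ^ j).
Proof. by move=> dM; rewrite coprimeXr // (coprime_dvdl dM). Qed.

Lemma hits_layers a x : hits a (M * q) x = \sum_(0 <= j < v.+1) layer a p j M x.
Proof.
by rewrite /hits (perm_big _ (perm_divisors_pfactor v p_pr cMp M0)) big_allpairs_dep.
Qed.

(** Forgetting the condition modulo [p ^ j] leaves a count of the same kind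
    for [M], with other residues.  This is why second moments are bounded
    uniformly in the residues. *)
Lemma layer_le_hits a j x : layer a p j M x <= hits (layer_residues a p j) M x.
Proof.
rewrite /layer /hits !big_seq; apply: ler_sum => d.
rewrite -dvdn_divisors // => dM; rewrite congr_indM ?cdp //.
by apply: ler_piMr; rewrite ?congr_ind_ge0 // lern1 leq_b1.
Qed.

(** By independence, the condition modulo [p ^ j] only costs the factor
    [p ^ - j]. *)
Lemma fiber_avg_layer a j x : (j <= v)%N ->
  fiber_avg M q (layer a p j M) x = z ^+ j * hits (layer_residues a p j) M x.
Proof.
move=> jv; rewrite /fiber_avg avg_sum mulr_sumr; apply: eq_big_seq => d.
rewrite -dvdn_divisors // => dM.
rewrite (@eq_avg _ _ (fun i => congr_ind (a (d * p ^ j)%N) d (x + i * M)%N *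
   congr_ind (a (d * p ^ j)%N) (p ^ j) (x + i * M)%N)); last first.
  by move=> i; rewrite congr_indM ?cdp.
rewrite -/(fiber_avg M q (fun y => congr_ind (a (d * p ^ j)%N) d y *
   congr_ind (a (d * p ^ j)%N) (p ^ j) y) x).
rewrite fiber_avgMl; last exact: periodic_congr_ind.
rewrite fiber_avg_congr_ind ?cdp //; last by rewrite dvdn_exp2l.
by rewrite mulrC natrX exprVn.
Qed.

Section Weight.

Variables (w : nat -> rat) (P : rat).
Hypotheses (w_ge0 : forall x, 0 <= w x) (wM : periodic M w).
Hypothesis second_moment : forall a, avg M (fun x => w x * hits a M x ^+ 2) <= P.

(** By [2 * s * t <= s ^ 2 + t ^ 2], bounding squares for all choices of
    residues also bounds products of counts for two different choices. *)
Lemma cross_moment a b : avg M (fun x => w x * (hits a M x * hits b M x)) <= P.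
Proof.
have -> : P = 2^-1 * (P + P) by field.
apply: le_trans (_ : 2^-1 * (avg M (fun x => w x * hits a M x ^+ 2)
   + avg M (fun x => w x * hits b M x ^+ 2)) <= _); last first.
  by rewrite ler_pM2l ?invr_gt0 // lerD.
rewrite -avgD -avgZ; apply: ler_avg => x.
have := mulr_ge0 (w_ge0 x) (sqr_ge0 (hits a M x - hits b M x)).
by nra.
Qed.

Lemma avg_mul_layer g a j : (j <= v)%N -> periodic M g ->
  avg (M * q) (fun x => w x * (g x * layer a p j M x)) =
  z ^+ j * avg M (fun x => w x * (g x * hits (layer_residues a p j) M x)).
Proof.
move=> jv gM; rewrite avg_fiber -avgZ; apply: eq_avg => x.
by rewrite fiber_avgMl // fiber_avgMl // fiber_avg_layer //; ring.
Qed.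

(** Growth of the second moment.  The layer 0 depends only on the residue
    modulo [M], hence does not see the factor [phi], of fiber average 1.  When
    the layer [k] is added to the sum [R] of the previous ones, the square
    increases by the product of [2 * R + layer k] with [layer k]; bounding
    [phi] by [c] and the first factor by a combination of [2 * k + 1] counts
    for [M], the fiber average of the second one gives [p ^ - k]. *)
Lemma second_moment_layers (c : rat) (phi : nat -> rat) a k :
    (forall x, 0 <= phi x <= c) -> (forall x, fiber_avg M q phi x = 1) ->
    (k <= v)%N ->
  avg (M * q) (fun x => w x * phi x * (\sum_(0 <= j < k.+1) layer a p j M x) ^+ 2)
    <= P * (1 + c * \sum_(0 <= i < k) (2 * i + 3)%:R * z ^+ i.+1).
Proof.
move=> phic phi1; have c0 : 0 <= c by have /andP[] := phic 0%N; apply: le_trans.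
elim: k => [_|k IHk kv].
  rewrite [X in 1 + c * X]big_nil mulr0 addr0 mulr1.
  apply: le_trans (second_moment a); rewrite avg_fiber le_eqVlt; apply/orP; left.
  have gM : periodic M (fun y => w y * hits a M y ^+ 2).
    by move=> y; rewrite wM periodic_hits.
  apply/eqP/eq_avg => x; rewrite -[RHS]mulr1 -(phi1 x) -(fiber_avgMl _ _ _ gM).
  by apply: eq_avg => j; rewrite big_nat1 layer0; ring.
rewrite [X in c * X]big_nat_recr //= [c * (_ + _)]mulrDr addrA [P * (_ + _)]mulrDr.
pose n j x := hits (layer_residues a p j) M x.
(* G bounds twice the sum of the layers up to k plus the layer k.+1. *)
pose G x := 2 * (\sum_(0 <= j < k.+1) n j x) + n k.+1 x.
have GM : periodic M G.
  move=> x; rewrite /G /n periodic_hits //; congr (2 * _ + _).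
  by apply: eq_bigr => j _; exact: periodic_hits.
apply: (@le_trans _ _ (avg (M * q)
   (fun x => w x * phi x * (\sum_(0 <= j < k.+1) layer a p j M x) ^+ 2) +
   c * avg (M * q) (fun x => w x * (G x * layer a p k.+1 M x)))).
  rewrite -avgZ -avgD; apply: ler_avg => x.
  rewrite (big_nat_recr k.+1) //=; set R := \sum_(0 <= j < _) _.
  set T := layer a p k.+1 M x.
  have T0 : 0 <= T by exact: layer_ge0.
  have R0 : 0 <= R by apply: sumr_ge0 => j _; exact: layer_ge0.
  have RG : 2 * R + T <= G x.
    rewrite lerD ?layer_le_hits // ler_pM2l //.
    by apply: ler_sum => j _; exact: layer_le_hits.
  have -> : w x * phi x * (R + T) ^+ 2 =
      w x * phi x * R ^+ 2 + w x * (phi x * ((2 * R + T) * T)) by ring.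
  rewrite lerD2l [leRHS]mulrCA ler_wpM2l //.
  have /andP[phi0 phile] := phic x.
  rewrite ler_pM ?mulr_ge0 ?addr_ge0 ?mulr_ge0 //.
  by rewrite ler_wpM2r.
apply: lerD; first exact/IHk/ltnW.
rewrite avg_mul_layer // [leRHS]mulrCA ler_wpM2l //.
rewrite [leRHS]mulrA [leRHS]mulrC ler_wpM2l ?exprn_ge0 ?invr_ge0 ?ler0n //.
rewrite (@eq_avg _ _ (fun x => 2 * (\sum_(0 <= j < k.+1) w x * (n j x * n k.+1 x))
    + w x * (n k.+1 x * n k.+1 x))); last first.
  move=> x; rewrite /G -mulr_sumr -mulr_suml -/(n k.+1 x); ring.
rewrite avgD avgZ avg_sum.
apply: le_trans (_ : 2 * (\sum_(0 <= j < k.+1) P) + P <= _).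
  by rewrite lerD ?cross_moment // ler_pM2l // ler_sum // => j _; rewrite cross_moment.
rewrite sumr_const_nat subn0 -mulr_natr natrD natrM -natr1 le_eqVlt.
by apply/orP; left; apply/eqP; ring.
Qed.

(** Used for the mean of [alpha ^ 2]: the proportion of a fiber occupied by
    classes of the layers [j >= 1] is at most the fiber average of the number
    of these classes. *)
Lemma avg_fiber_layers_sqr a :
  avg M (fun x =>
     w x * (fiber_avg M q (fun y => \sum_(1 <= j < v.+1) layer a p j M y) x) ^+ 2)
    <= P * (\sum_(1 <= j < v.+1) z ^+ j) ^+ 2.
Proof.
pose n j x := hits (layer_residues a p j) M x.
rewrite (@eq_avg _ _ (fun x => \sum_(1 <= i < v.+1) \sum_(1 <= j < v.+1)
    z ^+ i * z ^+ j * (w x * (n i x * n j x)))); last first.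
  move=> x; rewrite /fiber_avg avg_sum.
  rewrite (eq_big_nat _ _ (F2 := fun j => z ^+ j * n j x)); last first.
    by move=> j /andP[_ jv]; rewrite -fiber_avg_layer.
  rewrite expr2 big_distrlr mulr_sumr /=; apply: eq_bigr => i _.
  by rewrite mulr_sumr; apply: eq_bigr => j _; ring.
rewrite avg_sum expr2 big_distrlr mulr_sumr /=; apply: ler_sum => i _.
rewrite avg_sum mulr_sumr; apply: ler_sum => j _.
by rewrite avgZ mulrC ler_wpM2r ?cross_moment // mulr_ge0 // exprn_ge0 // invr_ge0.
Qed.

End Weight.

End PrimePower.

Lemma sum_expV_le (p : rat) v : 1 < p ->
  \sum_(1 <= j < v.+1) p^-1 ^+ j <= (p - 1)^-1.
Proof.
move=> p1; have p0 : p != 0 by lra.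
(* A telescoping sum: the subtracted term is the tail of the infinite series. *)
have -> : \sum_(1 <= j < v.+1) p^-1 ^+ j = (p - 1)^-1 - p^-1 ^+ v * (p - 1)^-1.
  elim: v => [|v IHv]; first by rewrite big_nil expr0 mul1r subrr.
  rewrite big_nat_recr //= IHv exprS; field; lra.
rewrite gerBl mulr_ge0 ?exprn_ge0 ?invr_ge0 //; lra.
Qed.

Lemma sum_odd_expV_le (p : rat) v : 1 < p ->
  \sum_(0 <= i < v) (2 * i + 3)%:R * p^-1 ^+ i.+1 <= (3 * p - 1) / (p - 1) ^+ 2.
Proof.
move=> p1; have p0 : p != 0 by lra.
(* Likewise, the subtracted term is the tail of the infinite series. *)
have -> : \sum_(0 <= i < v) (2 * i + 3)%:R * p^-1 ^+ i.+1 =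
   (3 * p - 1) / (p - 1) ^+ 2
   - p^-1 ^+ v * (((2 * v + 3)%:R * p - (2 * v + 1)%:R) / (p - 1) ^+ 2).
  elim: v => [|v IHv]; first by rewrite big_nil expr0 mul1r muln0 subrr.
  rewrite big_nat_recr //= IHv [p^-1 ^+ v.+1]exprS !natrD !natrM -[v.+1%:R]natr1.
  by field; lra.
rewrite gerBl mulr_ge0 ?exprn_ge0 ?invr_ge0 ?divr_ge0 ?sqr_ge0 //; first by lra.
rewrite subr_ge0 (@le_trans _ _ (2 * v + 3)%:R) ?ler_nat ?leq_add2l //.
by rewrite ler_peMr ?ler0n // ltW.
Qed.

(** * One step of the distortion *)

Definition in_class (r : nat -> nat) (x d : nat) : bool :=
  (1 < d)%N && (x == r d %[mod d])%N.

Definition covered (r : nat -> nat) (M x : nat) : bool :=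
  has (in_class r x) (divisors M).

(** The invariant of the induction: [P] bounds the second moments of all
    counts [hits a M], and [C] the mass of the points already covered. *)
Definition has_weight (r : nat -> nat) (M : nat) (P C : rat) : Prop :=
  exists w : nat -> rat,
    [/\ forall x, 0 <= w x,
        periodic M w,
        avg M w = 1,
        forall a, avg M (fun x => w x * hits a M x ^+ 2) <= P
      & avg M (fun x => w x * (covered r M x)%:R) <= C].

Lemma has_weight_uncovered r M P C : (0 < M)%N -> C < 1 -> has_weight r M P C ->
  exists x, forall d, (d %| M)%N -> (1 < d)%N -> (x != r d %[mod d])%N.
Proof.
move=> M0 C1 [w [w0 wM w1 _ wC]].
have [/existsP[x xP]|/existsPn cov] := boolP [exists x : 'I_M, ~~ covered r M x].
  exists x => d dM d1; apply: contraNN xP => xd; apply/hasP; exists d.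
    by rewrite -dvdn_divisors.
  by rewrite /in_class d1.
suff : 1 <= C by rewrite leNgt C1.
rewrite -w1 (le_trans _ wC) // /avg le_eqVlt; apply/orP; left.
apply/eqP; congr (_ / _); apply: eq_bigr => x _.
by have /negPn-> := cov x; rewrite mulr1.
Qed.

Lemma has_weight1 r : has_weight r 1 1 0.
Proof.
have avg1 f : avg 1 f = f 0%N by rewrite /avg big_ord1 divr1.
exists (fun=> 1); split=> // [a|]; rewrite avg1 mul1r.
  by rewrite /hits big_seq1 /congr_ind !modn1 eqxx expr1n.
by rewrite /covered /=.
Qed.

Lemma has_weight_mono r M P P' C C' : P <= P' -> C <= C' ->
  has_weight r M P C -> has_weight r M P' C'.
Proof.
move=> PP CC [w [w0 wM w1 wP wC]]; exists w; split=> //.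
  by move=> a; exact: le_trans (wP a) PP.
exact: le_trans wC CC.
Qed.

Lemma has_natr_le_sum (T : eqType) (a : T -> bool) (s : seq T) :
  (has a s)%:R <= \sum_(x <- s) (a x)%:R :> rat.
Proof.
elim: s => [|x s IHs]; first by rewrite big_nil.
rewrite big_cons /=; case: (a x) => /=; last by rewrite add0r.
by rewrite lerDl (le_trans _ IHs) ?ler0n.
Qed.

(** The new weight is the product of [w] with the factor of
    [exists_distortion], applied to the set [b] of points in a class whose
    modulus is divisible by [p].  As this factor has fiber average 1, the mass
    of the points covered earlier does not change. *)
Lemma has_weight_pfactor (delta : rat) r M p v P C :
    0 < delta < 1 -> prime p -> coprime M p -> (0 < M)%N ->
    has_weight r M P C ->
  has_weight r (M * p ^ v)
    (P * (1 + (1 - delta)^-1 * ((3 * p%:R - 1) / (p%:R - 1) ^+ 2)))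
    (C + P / (p%:R - 1) ^+ 2 / (4 * delta * (1 - delta))).
Proof.
move=> delta01 p_pr cMp M0 [w [w0 wM w1 wP wC]].
have /andP[d0 d1] := delta01.
have p1 : 1 < p%:R :> rat by rewrite ltr1n prime_gt1.
have P0 : 0 <= P.
  apply: le_trans (wP id); rewrite -(avg_cst 0 M0); apply: ler_avg => x.
  by rewrite mulr_ge0 ?sqr_ge0.
set q := (p ^ v)%N; have q0 : (0 < q)%N by rewrite expn_gt0 prime_gt0.
pose L := [seq (m * p ^ j)%N | j <- index_iota 1 v.+1, m <- divisors M].
pose b x := has (in_class r x) L.
have coveredE x : covered r (M * q) x = covered r M x || b x.
  rewrite /covered (eq_has_r (perm_mem (perm_divisors_pfactor v p_pr cMp M0))).
  rewrite /= has_cat; congr (has _ _ || _); last first.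
    by rewrite /b /L /index_iota subSS subn0.
  by rewrite -[RHS]map_id; apply: eq_map => m; rewrite expn0 muln1.
have bP x : b (x + M * q)%N = b x.
  apply: eq_in_has => d /allpairsPdep[j [m [jv mM ->]]].
  rewrite /in_class; congr (_ && _).
  have /dvdnP[k ->] : (m * p ^ j %| M * q)%N.
    move: jv mM; rewrite mem_index_iota -dvdn_divisors // => /andP[_ jv] mM.
    by rewrite dvdn_mul // dvdn_exp2l.
  by rewrite addnC modnMDl.
have [phi [phi01 phiP phi1 phib]] := exists_distortion delta01 q0 bP.
exists (fun x => w x * phi x); split.
- by move=> x; have /andP[] := phi01 x; move=> *; rewrite mulr_ge0.
- by move=> x; rewrite phiP mulnC periodicMn.
- rewrite avg_fiber -[RHS]w1; apply: eq_avg => x.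
  by rewrite fiber_avgMl // phi1 mulr1.
- move=> a; apply: (@le_trans _ _ (P * (1 + (1 - delta)^-1 *
      \sum_(0 <= i < v) (2 * i + 3)%:R * p%:R^-1 ^+ i.+1))); last first.
    rewrite ler_wpM2l // lerD2l ler_wpM2l ?invr_ge0 ?subr_ge0 ?(ltW d1) //.
    exact: sum_odd_expV_le.
  apply: le_trans (second_moment_layers p_pr cMp M0 w0 wM wP a phi01 phi1 (leqnn v)).
  by apply: ler_avg => x; rewrite hits_layers.
apply: (@le_trans _ _ (avg (M * q) (fun x => w x * phi x * (covered r M x)%:R)
    + avg (M * q) (fun x => w x * phi x * (b x)%:R))).
  rewrite -avgD; apply: ler_avg => x; rewrite coveredE -mulrDr ler_wpM2l //.
    by have /andP[phi0 _] := phi01 x; rewrite mulr_ge0.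
  by case: (covered _ _ _); case: (b x).
apply: lerD.
  apply: le_trans wC; rewrite avg_fiber le_eqVlt; apply/orP; left; apply/eqP/eq_avg => x.
  have cM : periodic M (fun y => w y * (covered r M y)%:R).
    move=> y; rewrite wM; congr (_ * _%:R).
    apply: congr1; apply: eq_in_has => d; rewrite -dvdn_divisors // => /dvdnP[k ->].
    by rewrite /in_class addnC modnMDl.
  have := fiber_avgMl q phi x cM; rewrite phi1 mulr1 => <-.
  by apply: eq_avg => j; ring.
have D0 : 0 < 4 * delta * (1 - delta) by rewrite !mulr_gt0 // subr_gt0.
pose alpha := fiber_avg M q (fun y => (b y)%:R).
apply: (@le_trans _ _ ((4 * delta * (1 - delta))^-1 *
    avg M (fun x => w x * alpha x ^+ 2))).
  rewrite avg_fiber -avgZ; apply: ler_avg => x.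
  rewrite {1}/fiber_avg
    (@eq_avg _ _ (fun j => (fun y => w y * (phi y * (b y)%:R)) (x + j * M)%N)).
    rewrite -/(fiber_avg M q (fun y => w y * (phi y * (b y)%:R)) x) fiber_avgMl //.
    by rewrite [leRHS]mulrCA ler_wpM2l // [leRHS]mulrC phib.
  by move=> j; rewrite mulrA.
rewrite mulrC ler_pM2r ?invr_gt0 //.
apply: (@le_trans _ _ (P * (\sum_(1 <= j < v.+1) p%:R^-1 ^+ j) ^+ 2)).
  apply: le_trans (avg_fiber_layers_sqr v p_pr cMp M0 w0 wP r).
  apply: ler_avg => x; rewrite ler_wpM2l //.
  have /andP[a0 _] := fiber_avg_ind_bounds M b x q0.
  have le_alpha : alpha x <=
      fiber_avg M q (fun y => \sum_(1 <= j < v.+1) layer r p j M y) x.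
    apply: ler_avg => j; apply: le_trans (has_natr_le_sum _ _) _.
    rewrite big_allpairs_dep; apply: ler_sum => i _; apply: ler_sum => m _.
    by rewrite ler_nat /in_class; case: (1 < _)%N.
  rewrite /alpha lerXn2r ?nnegrE //; first by apply: le_trans a0 le_alpha.
rewrite ler_wpM2l // -exprVn ler_sqr ?nnegrE; first exact: sum_expV_le.
  by apply: sumr_ge0 => j _; rewrite exprn_ge0 ?invr_ge0.
by rewrite invr_ge0 subr_ge0 ltW.
Qed.

(** * The numerical sequences *)

(** The contributions of [has_weight_pfactor] for [delta = 1 / 5], for which
    [1 / (1 - delta) = 5 / 4]; the constant factor
    [4 * delta * (1 - delta) = 16 / 25] is left out of [cost].  This value of
    [delta] is close to the best constant one. *)
Definition gain (p : nat) : rat := 5 / 4 * ((3 * p%:R - 1) / (p%:R - 1) ^+ 2).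

Definition growth (n : nat) : rat := \prod_(5 <= p < n | prime p) (1 + gain p).

Definition cost (n : nat) : rat :=
  \sum_(5 <= p < n | prime p) growth p / (p%:R - 1) ^+ 2.

Lemma gain_ge0 p : (0 < p)%N -> 0 <= gain p.
Proof.
move=> p0; have p1 : 1 <= p%:R :> rat by rewrite ler1n.
by apply: mulr_ge0; last (apply: divr_ge0; last exact: sqr_ge0); lra.
Qed.

Lemma growth_ge1 n : 1 <= growth n.
Proof.
rewrite /growth; elim/big_ind: _ => [|x y x1 y1|p /prime_gt0 p0].
- exact: lexx.
- by rewrite -[1]mulr1; apply: ler_pM.
- by rewrite lerDl; exact: gain_ge0.
Qed.

Lemma growth_ge0 n : 0 <= growth n.
Proof. exact: le_trans (growth_ge1 n). Qed.

Lemma growthS n : (5 <= n)%N ->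
  growth n.+1 = if prime n then growth n * (1 + gain n) else growth n.
Proof.
move=> n5; rewrite /growth big_mkcond big_nat_recr // -big_mkcond /=.
by case: ifP; rewrite ?mulr1.
Qed.

Lemma costS n : (5 <= n)%N ->
  cost n.+1 = if prime n then cost n + growth n / (n%:R - 1) ^+ 2 else cost n.
Proof.
move=> n5; rewrite /cost big_mkcond big_nat_recr // -big_mkcond /=.
by case: ifP; rewrite ?addr0.
Qed.

Lemma growth_small n : (n <= 5)%N -> growth n = 1.
Proof. by move=> n5; rewrite /growth big_geq. Qed.

Lemma cost_small n : (n <= 5)%N -> cost n = 0.
Proof. by move=> n5; rewrite /cost big_geq. Qed.

Lemma ler_growth m n : (m <= n)%N -> growth m <= growth n.
Proof.
elim: n => [|n IHn]; first by rewrite leqn0 => /eqP->.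
rewrite leq_eqVlt => /orP[/eqP->//|]; rewrite ltnS => /IHn/le_trans; apply.
case: (leqP 5 n) => n5; last by rewrite !growth_small // ltnW.
rewrite growthS //; case: ifP => // pr_n.
apply: ler_peMr; first exact: growth_ge0.
by rewrite lerDl; apply/gain_ge0/prime_gt0.
Qed.

Lemma ler_cost m n : (m <= n)%N -> cost m <= cost n.
Proof.
elim: n => [|n IHn]; first by rewrite leqn0 => /eqP->.
rewrite leq_eqVlt => /orP[/eqP->//|]; rewrite ltnS => /IHn/le_trans; apply.
case: (leqP 5 n) => n5; last by rewrite !cost_small // ltnW.
rewrite costS //; case: ifP => // pr_n.
by rewrite lerDl divr_ge0 ?growth_ge0 ?sqr_ge0.
Qed.

(** * A rounded computation up to 8400 *)

Definition small_primes : seq N :=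
  [:: 2; 3; 5; 7; 11; 13; 17; 19; 23; 29; 31; 37; 41; 43; 47; 53; 59; 61; 67;
      71; 73; 79; 83; 89]%num.

(** Trial division by the primes below 90.  Passing a composite number would
    only weaken the bounds, so that it is enough that all primes pass. *)
Definition maybe_prime (n : N) : bool :=
  all (fun q => N.leb n q || ~~ N.eqb (N.modulo n q) 0) small_primes.

Lemma maybe_primeP n : prime (N.to_nat n) -> maybe_prime n.
Proof.
move=> n_pr; have: all (N.ltb 1) small_primes by [].
apply: sub_all => q /N.ltb_lt q1; case: N.leb_spec0 => //= n_q.
apply/negP => /N.eqb_eq/N.Lcm0.mod_divide[k nE].
have : (N.to_nat q %| N.to_nat n)%N by rewrite nE N2Nat.inj_mul dvdn_mull.
by move=> /(prime_nt_dvdP n_pr) qn; apply: n_q; rewrite -(N2Nat.inj _ _ (qn _)); lia.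
Qed.

Definition up_div (a b : N) : N := N.succ (N.div a b).

Definition rat_of_N (a : N) : rat := (N.to_nat a)%:R.

Lemma rat_of_ND a b : rat_of_N (a + b) = rat_of_N a + rat_of_N b.
Proof. by rewrite /rat_of_N N2Nat.inj_add natrD. Qed.

Lemma rat_of_NM a b : rat_of_N (a * b) = rat_of_N a * rat_of_N b.
Proof. by rewrite /rat_of_N N2Nat.inj_mul natrM. Qed.

Lemma rat_of_N_ge0 a : 0 <= rat_of_N a. Proof. exact: ler0n. Qed.

Lemma le_up_div a b : (0 < b)%num -> rat_of_N a / rat_of_N b <= rat_of_N (up_div a b).
Proof.
move=> b0; have /(_ (not_eq_sym (N.lt_neq _ _ b0))) := N.mul_succ_div_gt a b.
rewrite ler_pdivrMr; last by rewrite ltr0n; lia.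
by rewrite -rat_of_NM ler_nat N.mul_comm -/(up_div a b); lia.
Qed.

(** In a state [(k, g, c)], the integers [g] and [c] are upper bounds for
    [growth k.+1] and [cost k.+1] in units of [1 / scale].  The first component
    is the predecessor of the candidate prime, which avoids subtractions. *)
Definition bound_step (s : N * N * N) : N * N * N :=
  let: (k, g, c) := s in
  if maybe_prime (N.succ k) then
    (N.succ k, g + up_div (g * (5 * (3 * k + 2))) (4 * (k * k)),
     c + up_div g (k * k))%num
  else (N.succ k, g, c).

Definition valid_bound (scale : N) (s : N * N * N) : Prop :=
  let: (k, g, c) := s in
  [/\ (4 <= k)%num, growth (N.to_nat k).+1 <= rat_of_N g / rat_of_N scale
    & cost (N.to_nat k).+1 <= rat_of_N c / rat_of_N scale].

Lemma valid_bound_step scale s : (0 < scale)%num ->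
  valid_bound scale s -> valid_bound scale (bound_step s).
Proof.
move=> scale0; case: s => [[k g] c] [k4 gk ck].
have k5 : (5 <= (N.to_nat k).+1)%N by lia.
have s0 : 0 < rat_of_N scale by rewrite ltr0n; lia.
have k0 : 0 < rat_of_N k by rewrite ltr0n; lia.
have kE : N.to_nat (N.succ k) = (N.to_nat k).+1 by lia.
rewrite /bound_step /=; case: ifPn => mpk; last first.
  have npr : prime (N.to_nat k).+1 = false.
    by apply: contraNF mpk => pr; apply: maybe_primeP; rewrite kE.
  by split; [lia | rewrite kE growthS // npr | rewrite kE costS // npr].
have kk : rat_of_N (k * k) = rat_of_N k ^+ 2 by rewrite rat_of_NM.
have nk : (N.to_nat k).+1%:R = rat_of_N k + 1 :> rat by rewrite -natr1.
split; first by lia.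
- rewrite kE growthS // rat_of_ND mulrDl.
  have u0 : 0 <= rat_of_N (up_div (g * (5 * (3 * k + 2))) (4 * (k * k))) / rat_of_N scale.
    by rewrite divr_ge0 ?rat_of_N_ge0.
  case: ifP => _; last by apply: le_trans gk _; rewrite lerDl.
  rewrite mulrDr mulr1 lerD //.
  have : (0 < 4 * (k * k))%num by lia.
  move=> /(le_up_div (g * (5 * (3 * k + 2)))) le_up.
  apply: (@le_trans _ _ (rat_of_N g / rat_of_N scale * gain (N.to_nat k).+1)).
    by apply: ler_wpM2r; first exact: gain_ge0.
  rewrite mulrAC ler_pM2r ?invr_gt0 //; apply: le_trans le_up.
  rewrite !rat_of_NM rat_of_ND rat_of_NM /gain nk le_eqVlt; apply/orP; left; apply/eqP.
  rewrite /rat_of_N -[N.to_nat 5]/5%N -[N.to_nat 4]/4%N.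
  rewrite -[N.to_nat 3]/3%N -[N.to_nat 2]/2%N.
  rewrite -/(rat_of_N k) -/(rat_of_N g).
  by field; lra.
- rewrite kE costS // rat_of_ND mulrDl.
  have u0 : 0 <= rat_of_N (up_div g (k * k)) / rat_of_N scale.
    by rewrite divr_ge0 ?rat_of_N_ge0.
  case: ifP => _; last by apply: le_trans ck _; rewrite lerDl.
  rewrite lerD //.
  have : (0 < k * k)%num by lia.
  move=> /(le_up_div g) le_up.
  apply: (@le_trans _ _ (rat_of_N g / rat_of_N scale / rat_of_N k ^+ 2)).
    by rewrite nk addrK ler_wpM2r // invr_ge0 sqr_ge0.
  by rewrite mulrAC ler_pM2r ?invr_gt0 // -kk.
Qed.

Lemma rat_of_N_div_le (a b : N) (c d : nat) : (0 < b)%num -> (0 < d)%N ->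
  (a * N.of_nat d <= N.of_nat c * b)%num -> rat_of_N a / rat_of_N b <= c%:R / d%:R.
Proof.
move=> b0 d0 le_ab; rewrite ler_pdivrMr; last by rewrite ltr0n; lia.
rewrite mulrAC ler_pdivlMr ?ltr0n // -!natrM ler_nat; lia.
Qed.

(** The scale is kept abstract since a large binary constant may be unfolded
    into unary when terms that contain its image in [nat] are compared. *)
Lemma valid_bound_iter scale n : (0 < scale)%num ->
  valid_bound scale (N.iter n bound_step (4, scale, 0)%num).
Proof.
move=> scale0; apply: N.iter_invariant.
  by move=> s; exact: valid_bound_step.
have s0 : 0 < rat_of_N scale by rewrite ltr0n; lia.
split; first exact: N.le_refl.
  by rewrite growth_small // divff // gt_eqF.
by rewrite cost_small // divr_ge0 ?rat_of_N_ge0.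
Qed.

Lemma growth_cost_8400 : growth (210 * 40)%N <= 435 /\ cost (210 * 40)%N <= 526 / 1000.
Proof.
pose scale := 1000000000%num.
have scale0 : (0 < scale)%num by [].
have : N.iter 8395 bound_step (4, scale, 0)%num = (8399, 434959167941, 525826827)%num.
  by vm_compute.
have g_le : (434959167941 * N.of_nat 1 <= N.of_nat 435 * scale)%num by vm_compute.
have c_le : (525826827 * N.of_nat 1000 <= N.of_nat 526 * scale)%num by vm_compute.
move: (@valid_bound_iter scale 8395 scale0) => /[swap] ->.
clearbody scale; move=> [_ growth_le cost_le].
have e : (N.to_nat 8399).+1 = (210 * 40)%N by lia.
rewrite e in growth_le cost_le.
split; last exact: le_trans cost_le (rat_of_N_div_le scale0 _ c_le).
by rewrite -[435]divr1; apply: le_trans growth_le (rat_of_N_div_le scale0 _ g_le).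
Qed.

(** * The tail *)

Lemma prime_coprime_210 p : prime p -> (7 < p)%N -> coprime p 210%N.
Proof.
move=> p_pr p7; rewrite prime_coprime //; apply/negP.
rewrite (_ : 210 = 2 * 3 * 5 * 7)%N // !Euclid_dvdM //.
by move=> /orP[/orP[/orP[]|]|] /dvdn_leq; lia.
Qed.

Lemma count_coprime_210 t :
  count (coprime^~ 210%N) (index_iota (210 * t) (210 * t.+1))%N = 48%N.
Proof.
rewrite /index_iota mulnS addnK -[X in iota X](addn0 (210 * t)%N) iotaDl count_map.
rewrite (eq_count (a2 := coprime^~ 210%N)) //.
by move=> i; rewrite [LHS]/= -coprime_modl mulnC modnMDl coprime_modl.
Qed.

Lemma prod_coprime_210 t (y : rat) :
  \prod_(210 * t <= p < 210 * t.+1 | coprime p 210%N) y = y ^+ 48.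
Proof. by rewrite big_const_seq count_coprime_210 iter_mulr_1. Qed.

Lemma sum_coprime_210 t (y : rat) :
  \sum_(210 * t <= p < 210 * t.+1 | coprime p 210%N) y = y *+ 48.
Proof. by rewrite big_const_seq count_coprime_210 iter_addr_0. Qed.

(** The product [(1 + y) ^ k * (1 - k * y)] does not increase with [k], as
    [(1 + y) * (1 - (k + 1) * y) <= 1 - k * y]. *)
Lemma bernoulli_inv (y : rat) k : 0 <= y -> k%:R * y < 1 ->
  (1 + y) ^+ k <= (1 - k%:R * y)^-1.
Proof.
move=> y0 ky.
have D0 : 0 < 1 - k%:R * y by rewrite subr_gt0.
rewrite -div1r ler_pdivlMr //.
have y1 : (1 + y) ^+ k >= 0 by rewrite exprn_ge0 //; lra.
elim: k {ky D0} y1 => [|k IHk] y1; first by rewrite expr0; lra.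
have y1' : (1 + y) ^+ k >= 0 by rewrite exprn_ge0 //; lra.
apply: le_trans (IHk y1'); rewrite exprSr -mulrA ler_wpM2l //.
have k0 : 0 <= k%:R :> rat by [].
rewrite -natr1; nra.
Qed.

(** With [x >= u + 2] it suffices that
    [(3 * x - 1) * (x - 2) <= 3 * (x - 1) ^ 2], whose two sides differ by
    [x + 1]. *)
Lemma gain_le_inv (u x : rat) : 0 < u -> u + 2 <= x ->
  5 / 4 * ((3 * x - 1) / (x - 1) ^+ 2) <= 15 / 4 / u.
Proof.
move=> u0 ux; have -> : 15 / 4 / u = 5 / 4 * (3 / u) by field; lra.
apply: ler_wpM2l; first by lra.
rewrite ler_pdivrMr; last by rewrite exprn_gt0 //; lra.
rewrite mulrAC ler_pdivlMr; last by lra.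
by apply: le_trans (_ : (3 * x - 1) * (x - 2) <= _); nra.
Qed.

Section Block.

Variables (t : nat) (u : rat).
Hypotheses (t_ge40 : (40 <= t)%N) (u_def : u = (210 * t)%:R - 1).

Let u_large : 480 <= u.
Proof.
rewrite u_def natrM; have : 40 <= t%:R :> rat by rewrite ler_nat.
by lra.
Qed.

Let prime_block p : (210 * t <= p)%N -> prime p -> coprime p 210%N.
Proof.
move=> tp p_pr; apply: (prime_coprime_210 p_pr); apply: leq_trans tp.
by clear -t_ge40; lia.
Qed.

Lemma prime_gt_block p : (210 * t <= p)%N -> prime p -> u + 2 <= p%:R.
Proof.
move=> tp p_pr; have cop := prime_block tp p_pr.
have : (210 * t + 1 <= p)%N.
  rewrite addn1 ltn_neqAle tp andbT; apply/eqP => e.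
  by move: cop; rewrite -e /coprime gcdnC gcdnMr.
by rewrite -(ler_nat rat) natrD u_def; lra.
Qed.

Lemma gain_block p : (210 * t <= p)%N -> prime p -> gain p <= 15 / 4 / u.
Proof.
move=> tp p_pr; apply: gain_le_inv (prime_gt_block tp p_pr).
by have uL := u_large; lra.
Qed.

(** At most 48 factors, each at most [1 + y] with [y = 15 / (4 * u)], and
    [48 * y = 180 / u]. *)
Lemma growth_block : growth (210 * t.+1)%N <= growth (210 * t)%N * (u / (u - 180)).
Proof.
have uL := u_large; have u0 : u != 0 by lra.
pose y : rat := 15 / 4 / u.
have y0 : 0 <= y by rewrite /y; apply: mulr_ge0; rewrite ?invr_ge0; lra.
have y48 : 48%:R * y = 180 / u by rewrite /y; field.
have y1 : 48%:R * y < 1 by rewrite y48 ltr_pdivrMr; lra.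
have -> : u / (u - 180) = (1 - 48%:R * y)^-1 by rewrite y48; field; lra.
have gy p : (210 * t <= p)%N -> prime p -> gain p <= y by exact: gain_block.
clearbody y; rewrite /growth (@big_cat_nat _ _ _ (210 * t)%N) /=; try lia.
apply: ler_wpM2l; first exact: growth_ge0.
apply: le_trans (bernoulli_inv y0 y1).
rewrite -(prod_coprime_210 t) big_mkcond [leRHS]big_mkcond /=.
rewrite big_seq [leRHS]big_seq; apply: ler_prod => p.
rewrite mem_index_iota => /andP[tp _].
case: ifPn => [p_pr|_].
  rewrite (prime_block tp p_pr) lerD2l (gy p tp p_pr) andbT.
  by apply: addr_ge0; [exact: ler01 | apply/gain_ge0/prime_gt0].
by case: ifP => _; rewrite ler01 /=; [rewrite lerDl | exact: lexx].
Qed.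

Lemma cost_block :
  cost (210 * t.+1)%N <= cost (210 * t)%N + 48 * growth (210 * t.+1)%N / u ^+ 2.
Proof.
have uL := u_large.
rewrite /cost (@big_cat_nat _ _ _ (210 * t)%N) /=; try lia.
rewrite lerD2l.
have -> : 48 * growth (210 * t.+1)%N / u ^+ 2 =
    (growth (210 * t.+1)%N / u ^+ 2) *+ 48 by rewrite -[RHS]mulr_natl mulrA.
have G0 : 0 <= growth (210 * t.+1)%N / u ^+ 2.
  by apply: mulr_ge0; rewrite ?invr_ge0 ?sqr_ge0 ?growth_ge0.
rewrite -(sum_coprime_210 t) big_mkcond [leRHS]big_mkcond /=.
rewrite big_seq [leRHS]big_seq; apply: ler_sum => p.
rewrite mem_index_iota => /andP[tp pt].
case: ifPn => [p_pr|_]; last by case: ifP.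
have pu := prime_gt_block tp p_pr.
rewrite (prime_block tp p_pr); apply: ler_pM.
- exact: growth_ge0.
- by rewrite invr_ge0; exact: sqr_ge0.
- exact/ler_growth/ltnW.
rewrite lef_pV2 ?posrE; try by apply: exprn_gt0; lra.
by apply: lerXn2r; rewrite ?nnegrE; lra.
Qed.

End Block.

(** The left-hand side does not increase with [t].  In terms of
    [u = 210 * t - 1], going to the next block replaces [u - 180] by [u + 30]
    and, by [growth_block], multiplies the growth by at most
    [u / (u - 180)]: the potential drops by a share of order [30 / u] of
    itself, which pays for the cost of the block, about [48 / u ^ 2] times the
    growth, as soon as the coefficient exceeds [48 / 30] by a small margin;
    hence [17 / 10].  At [t = 40] the computed bounds give about [0.616]. *)
Lemma cost_potential t : (40 <= t)%N ->
  cost (210 * t)%N + 17 / 10 * growth (210 * t)%N / ((210 * t)%:R - 181) < 16 / 25.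
Proof.
elim: t => [/notF[]|t IHt]; rewrite leq_eqVlt => /orP[/eqP <-|].
  have [g c] := growth_cost_8400; rewrite natrM.
  apply: (@le_lt_trans _ _ (526 / 1000 + 17 / 10 * 435 / (210 * 40 - 181))).
    apply: lerD; first exact: c.
    apply: ler_wpM2r; first by rewrite invr_ge0; lra.
    by apply: ler_wpM2l; [lra | exact: g].
  by rewrite -ltrBrDl ltr_pdivrMr; lra.
rewrite ltnS => t40; apply: le_lt_trans (IHt t40).
pose u : rat := (210 * t)%:R - 1; have u_def : u = (210 * t)%:R - 1 by [].
have cb := cost_block t40 u_def; have gb := growth_block t40 u_def.
have G0 := growth_ge0 (210 * t).
have u480 : 480 <= u.
  rewrite u_def natrM; have : 40 <= t%:R :> rat by rewrite ler_nat.
  by lra.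
have -> : (210 * t)%:R - 181 = u - 180 :> rat by rewrite u_def; ring.
have -> : (210 * t.+1)%:R - 181 = u + 30 :> rat.
  by rewrite u_def !natrM -natr1; ring.
clearbody u => {u_def IHt}.
apply: le_trans (lerD cb (lexx _)) _; rewrite -addrA lerD2l.
set G' := growth (210 * t.+1)%N in gb *; set G := growth (210 * t)%N in gb G0 *.
have -> : 48 * G' / u ^+ 2 + 17 / 10 * G' / (u + 30) =
    G' * (48 / u ^+ 2 + 17 / 10 / (u + 30)) by ring.
have h0 : 0 <= 48 / u ^+ 2 + 17 / 10 / (u + 30).
  apply: addr_ge0; apply: mulr_ge0; try lra; rewrite invr_ge0; last by lra.
  exact: sqr_ge0.
apply: le_trans (ler_wpM2r h0 gb) _.
have -> : G * (u / (u - 180)) * (48 / u ^+ 2 + 17 / 10 / (u + 30)) =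
  G * ((48 / u + 17 / 10 * (u / (u + 30))) / (u - 180)) by field; lra.
have -> : 17 / 10 * G / (u - 180) = G * (17 / 10 / (u - 180)) by ring.
apply: ler_wpM2l; first by lra.
rewrite ler_pM2r; last by rewrite invr_gt0; lra.
have -> : 48 / u + 17 / 10 * (u / (u + 30)) =
   17 / 10 - (3 * u - 1440) / (u * (u + 30)) by field; lra.
rewrite gerBl; apply: mulr_ge0; first by lra.
by rewrite invr_ge0; apply: mulr_ge0; lra.
Qed.

Theorem cost_lt n : cost n < 16 / 25.
Proof.
have n40 : (40 <= n + 40)%N by rewrite leq_addl.
apply: le_lt_trans (cost_potential n40).
apply: le_trans (ler_cost (_ : n <= 210 * (n + 40))%N) _; first by lia.
rewrite lerDl; apply: mulr_ge0.
  by apply: mulr_ge0; [lra | exact: growth_ge0].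
rewrite invr_ge0 natrM natrD; have : 0 <= n%:R :> rat by exact: ler0n.
by lra.
Qed.

(** * Covering systems *)

(** Exponents [logn p Q] vanish unless [p] is a prime divisor of [Q], so that
    the index can run through all integers. *)
Definition smooth_part (Q n : nat) : nat := (\prod_(0 <= p < n) p ^ logn p Q)%N.

Lemma smooth_part_all Q : (0 < Q)%N -> smooth_part Q Q.+1 = Q.
Proof. by move=> Q0; rewrite -[RHS](partnT Q0) /partn. Qed.

Lemma smooth_part_gt0 Q n : (0 < smooth_part Q n)%N.
Proof.
apply: prodn_gt0 => p; rewrite expn_gt0 lognE.
by case: (posnP p) => // ->.
Qed.

Lemma coprime_smooth_part Q n : prime n -> coprime (smooth_part Q n) n.
Proof.
move=> n_pr; rewrite /smooth_part big_seq; elim/big_ind: _ => [|a b an bn|p].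
- exact: coprime1n.
- by rewrite coprimeMl an.
rewrite mem_index_iota => /andP[_ pn]; case: (posnP p) => [->|p0].
  by rewrite lognE coprime1n.
by rewrite coprimeXl // coprime_sym prime_coprime // gtnNdvd.
Qed.

Lemma has_weight_smooth_part r Q n : coprime Q 6 ->
  has_weight r (smooth_part Q n) (growth n) (cost n / (16 / 25)).
Proof.
move=> Q6; elim: n => [|n IHn].
  rewrite growth_small // cost_small // mul0r /smooth_part big_geq //.
  exact: has_weight1.
rewrite /smooth_part big_nat_recr //= -/(smooth_part Q n).
have [logn0|v_gt0] := posnP (logn n Q).
  rewrite logn0 muln1; apply: has_weight_mono IHn; first exact: ler_growth.
  by apply: ler_wpM2r; [rewrite invr_ge0; lra | exact: ler_cost].
have : n \in primes Q by rewrite -logn_gt0.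
rewrite mem_primes => /and3P[n_pr _ nQ].
(* As Q is coprime to 6, its primes are in the range of the product growth. *)
have n5 : (5 <= n)%N.
  have : coprime n 6 by exact: coprime_dvdl nQ Q6.
  by case: n n_pr {IHn v_gt0 nQ} => [|[|[|[|[|n]]]]].
have delta01 : ((0 : rat) < 1 / 5) && ((1 / 5 : rat) < 1) by apply/andP; split; lra.
have := has_weight_pfactor (logn n Q) delta01 n_pr
  (coprime_smooth_part Q n_pr) (smooth_part_gt0 Q n) IHn.
rewrite (growthS n5) (costS n5) n_pr /gain.
have -> : (1 - 1 / 5)^-1 = 5 / 4 :> rat by field.
have -> : 4 * (1 / 5) * (1 - 1 / 5) = 16 / 25 :> rat by field.
by rewrite -mulrDl.
Qed.

(** Choosing a residue for every divisor of [Q], even those that are not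
    moduli of the covering system, loses nothing and dispenses with the set of
    moduli. *)
Theorem uncovered_of_coprime_6 (Q : nat) (r : nat -> nat) :
  (0 < Q)%N -> coprime Q 6 ->
  exists x, forall d, (d %| Q)%N -> (1 < d)%N -> (x != r d %[mod d])%N.
Proof.
move=> Q0 Q6; have := has_weight_smooth_part r Q.+1 Q6.
rewrite smooth_part_all // => /has_weight_uncovered; apply=> //.
by rewrite ltr_pdivrMr; [rewrite mul1r; exact: cost_lt | lra].
Qed.

Local Close Scope ring_scope.

Theorem theorem1 (k : nat) (a : 'I_k -> int) (m : 'I_k -> nat)
    (Hcov : distinct_covering_system a m) :
  exists i : 'I_k, (2 %| m i) \/ (3 %| m i).
Proof.
case: Hcov => -[m_gt0 cov] m_inj m_gt1.
have [/existsP[i /orP]|/existsPn m6] := boolP [exists i, (2 %| m i) || (3 %| m i)].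
  by exists i.
pose r d := if [pick i | m i == d] is Some i then `|(a i %% (m i)%:Z)%Z|%N else 0.
pose Q := \prod_i m i.
have Q0 : 0 < Q by apply: prodn_gt0.
have Q6 : coprime Q 6.
  rewrite /Q; elim/big_ind: _ => [|b c b6 c6|i _]; first exact: coprime1n.
    by rewrite coprimeMl b6.
  rewrite (_ : 6 = 2 * 3) // coprimeMr ![coprime (m i) _]coprime_sym.
  by rewrite !prime_coprime // -negb_or.
have [x x_uncovered] := uncovered_of_coprime_6 r Q0 Q6.
have [i xi] := cov (Posz x).
have mQ : m i %| Q by rewrite /Q (bigD1 i) //= dvdn_mulr.
have /negP[] := x_uncovered (m i) mQ (m_gt1 i).
rewrite /r; case: pickP => [j /eqP /m_inj ->|/(_ i)]; last by rewrite eqxx.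
have mi0 : Posz (m i) != 0%R by rewrite eqz_nat -lt0n.
rewrite -eqz_nat -!modz_nat gez0_abs ?modz_ge0 // modz_mod.
exact/eqP.
Qed.
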